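(* Let $\mathcal A$ be a Hopf superalgebra over $\mathbb C$. Then the dimension of the space of left integrals on $\mathcal A$ is not greater than $1$. In particular, any integral on $\mathcal A$ is even or odd (i.e. homogeneous with respect to the $\mathbb Z_2$-gradation of $\mathcal A^*$).
   Context: All vector spaces are over $\mathbb C$ and $\mathbb Z_2$-graded, and $[x]\in\mathbb Z_2$ denotes the degree of a homogeneous element $x$. All algebraic notions and constructions are meant in the super sense, with the sign rule; e.g. for homogeneous linear maps $f,g$ one has $(f\otimes g)(a\otimes b)=(-1)^{[g][a]}f(a)\otimes g(b)$. $\mathcal A$ has comultiplication $\Delta$, counit $\varepsilon$, antipode $S$ (not assumed invertible) and unit $1_{\mathcal A}$. The full linear dual is $\mathcal A^*$. A left integral on $\mathcal A$ is a linear form $\int\in\mathcal A^*$ with $(\mathrm{id}_{\mathcal A}\otimes\int)\Delta(a)=1_{\mathcal A}\int(a)$ for all $a\in\mathcal A$; equivalently $a^*\cdot\int=a^*(1_{\mathcal A})\int$ for all $a^*\in\mathcal A^*$, where $\cdot$ is the multiplication in $\mathcal A^*$ deduced from $\Delta$. A right integral is a linear form with $(\int\otimes\mathrm{id}_{\mathcal A})\Delta(a)=1_{\mathcal A}\int(a)$ for all $a\in\mathcal A$. *)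

(* Defs.v *)
From HB Require Import structures.
From mathcomp Require Import all_boot all_algebra.
From mathcomp Require Import all_classical reals prodnormedzmodule.
From mathcomp Require Export complex.

Set Implicit Arguments.
Unset Strict Implicit.
Unset Printing Implicit Defensive.

Import GRing.Theory.
Local Open Scope quotient_scope.
Local Open Scope ring_scope.

Reserved Notation "v \ot w" (at level 40, left associativity).

Notation bilinear_map f := (bilinear_for *:%R *:%R f).

Definition linear_pack (K : fieldType) (U V : lmodType K) (f : U -> V)
    (lf : linear f) : {linear U -> V} :=
  HB.pack f (GRing.isLinear.Build K U V *:%R f lf).

Section Hom.
Context (K : fieldType) (U V : lmodType K).
Implicit Types f g h : {linear U -> V}.

Lemma linear_ext f g : f =1 g -> f = g.
Proof.
case: f g => f [[fD] [fZ]] [g [[gD] [gZ]]] /= /funext fg.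
case: _ / fg gD gZ => gD gZ; congr (GRing.Linear.Pack (GRing.Linear.Class _ _)).
  by congr GRing.isNmodMorphism.Axioms_; exact: Prop_irrelevance.
by congr GRing.isScalable.Axioms_; exact: Prop_irrelevance.
Qed.

Let hom_add f g : {linear U -> V} := f \+ g.
Let hom_opp f : {linear U -> V} := \- f.
Let hom_zero : {linear U -> V} := \0.
Let hom_scale (a : K) f : {linear U -> V} := a \*: f.

Let hom_addA : associative hom_add.
Proof. by move=> f g h; apply: linear_ext => u /=; rewrite addrA. Qed.
Let hom_addC : commutative hom_add.
Proof. by move=> f g; apply: linear_ext => u /=; rewrite addrC. Qed.
Let hom_add0 : left_id hom_zero hom_add.
Proof. by move=> f; apply: linear_ext => u /=; rewrite add0r. Qed.
Let hom_addN : left_inverse hom_zero hom_opp hom_add.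
Proof. by move=> f; apply: linear_ext => u /=; rewrite addNr. Qed.

HB.instance Definition _ := GRing.isZmodule.Build {linear U -> V}
  hom_addA hom_addC hom_add0 hom_addN.

Let hom_scaleA a b f : hom_scale a (hom_scale b f) = hom_scale (a * b) f.
Proof. by apply: linear_ext => u /=; rewrite scalerA. Qed.
Let hom_scale1 : left_id 1 hom_scale.
Proof. by move=> f; apply: linear_ext => u /=; rewrite scale1r. Qed.
Let hom_scaleDr : right_distributive hom_scale +%R.
Proof. by move=> a f g; apply: linear_ext => u /=; rewrite scalerDr. Qed.
Let hom_scaleDl f : {morph hom_scale^~ f : a b / a + b}.
Proof. by move=> a b; apply: linear_ext => u /=; rewrite scalerDl. Qed.

HB.instance Definition _ := GRing.Zmodule_isLmodule.Build K {linear U -> V}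
  hom_scaleA hom_scale1 hom_scaleDr hom_scaleDl.

Lemma homDE f g u : (f + g) u = f u + g u. Proof. by []. Qed.
Lemma homZE (a : K) f u : (a *: f) u = a *: f u. Proof. by []. Qed.
Lemma hom0E u : (0 : {linear U -> V}) u = 0. Proof. by []. Qed.

End Hom.

Section Tensor.
Context (K : fieldType) (V W : lmodType K).

(* A finite formal sum of pure tensors is a list of pairs; two of them are
   identified when no bilinear map on V x W, into any vector space, tells them
   apart. *)
Definition tensor_eqv (s t : seq (V * W)) : bool :=
  `[< forall (U : lmodType K) (f : V -> W -> U), bilinear_map f ->
      \sum_(x <- s) f x.1 x.2 = \sum_(x <- t) f x.1 x.2 >].

Lemma tensor_eqv_equiv : equiv_class_of tensor_eqv.
Proof.
split=> [s|s t|t s u].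
- exact/asboolP.
- by apply/asboolP/asboolP => h U f bf; rewrite h.
- by move=> /asboolP st /asboolP tu; apply/asboolP => U f bf; rewrite st ?tu.
Qed.

Canonical tensor_equiv := EquivRelPack tensor_eqv_equiv.

Definition tensor : Type := {eq_quot tensor_equiv}.

HB.instance Definition _ := Choice.on tensor.

Definition tensor_pi (s : seq (V * W)) : tensor := \pi_{eq_quot tensor_equiv} s.
Definition tensor_repr (x : tensor) : seq (V * W) :=
  repr (x : {eq_quot tensor_equiv}).

(* The linear map induced by a bilinear f; meaningless for other f. *)
Definition tlift (U : lmodType K) (f : V -> W -> U) (x : tensor) : U :=
  \sum_(p <- tensor_repr x) f p.1 p.2.

Lemma tlift_pi (U : lmodType K) (f : V -> W -> U) s : bilinear_map f ->
  tlift f (tensor_pi s) = \sum_(p <- s) f p.1 p.2.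
Proof.
move=> bf; have /eqP := reprK (\pi_{eq_quot tensor_equiv} s).
by rewrite eqmodE => /asboolP; exact.
Qed.

Lemma tensor_eqP (x y : tensor) :
  (forall (U : lmodType K) (f : V -> W -> U), bilinear_map f ->
     tlift f x = tlift f y) -> x = y.
Proof.
move=> xy; rewrite -[x](reprK (x : {eq_quot tensor_equiv})).
rewrite -[y](reprK (y : {eq_quot tensor_equiv})); apply/eqP; rewrite eqmodE.
by apply/asboolP => U f /xy.
Qed.

Let tadd (x y : tensor) := tensor_pi (tensor_repr x ++ tensor_repr y).
Let tzero := tensor_pi [::].
Let tscale (a : K) (x : tensor) :=
  tensor_pi [seq (a *: p.1, p.2) | p <- tensor_repr x].
Let topp (x : tensor) := tscale (-1) x.

Let tlift_add (U : lmodType K) (f : V -> W -> U) x y : bilinear_map f ->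
  tlift f (tadd x y) = tlift f x + tlift f y.
Proof. by move=> bf; rewrite tlift_pi// big_cat. Qed.

Let tlift_zero (U : lmodType K) (f : V -> W -> U) : bilinear_map f -> tlift f tzero = 0.
Proof. by move=> bf; rewrite tlift_pi// big_nil. Qed.

Let tlift_scale (U : lmodType K) (f : V -> W -> U) a x : bilinear_map f ->
  tlift f (tscale a x) = a *: tlift f x.
Proof.
move=> bf; rewrite tlift_pi// big_map scaler_sumr; apply: eq_bigr => p _.
exact: (scalable_linear (bf.1 p.2)).
Qed.

Let taddA : associative tadd.
Proof. by move=> x y z; apply: tensor_eqP => U f bf; rewrite !tlift_add// addrA. Qed.
Let taddC : commutative tadd.
Proof. by move=> x y; apply: tensor_eqP => U f bf; rewrite !tlift_add// addrC. Qed.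
Let tadd0 : left_id tzero tadd.
Proof.
by move=> x; apply: tensor_eqP => U f bf; rewrite tlift_add// tlift_zero ?add0r.
Qed.
Let taddN : left_inverse tzero topp tadd.
Proof.
move=> x; apply: tensor_eqP => U f bf.
by rewrite tlift_add// tlift_zero// tlift_scale// scaleN1r addNr.
Qed.

HB.instance Definition _ := GRing.isZmodule.Build tensor taddA taddC tadd0 taddN.

Let tscaleA a b x : tscale a (tscale b x) = tscale (a * b) x.
Proof. by apply: tensor_eqP => U f bf; rewrite !tlift_scale// scalerA. Qed.
Let tscale1 : left_id 1 tscale.
Proof. by move=> x; apply: tensor_eqP => U f bf; rewrite tlift_scale// scale1r. Qed.
Let tscaleDr : right_distributive tscale +%R.
Proof.
move=> a x y; apply: tensor_eqP => U f bf.
by rewrite [RHS]tlift_add// !tlift_scale// [X in a *: X]tlift_add// scalerDr.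
Qed.
Let tscaleDl x : {morph tscale^~ x : a b / a + b}.
Proof.
move=> a b; apply: tensor_eqP => U f bf.
by rewrite [RHS]tlift_add// !tlift_scale// scalerDl.
Qed.

HB.instance Definition _ := GRing.Zmodule_isLmodule.Build K tensor
  tscaleA tscale1 tscaleDr tscaleDl.

Definition tpure (v : V) (w : W) : tensor := tensor_pi [:: (v, w)].

Local Notation "v \ot w" := (tpure v w) : ring_scope.

Lemma tlift_linear (U : lmodType K) (f : V -> W -> U) : bilinear_map f -> linear (tlift f).
Proof. by move=> bf a x y; rewrite [LHS]tlift_add// tlift_scale. Qed.

Lemma tliftE (U : lmodType K) (f : V -> W -> U) v w : bilinear_map f -> tlift f (v \ot w) = f v w.
Proof. by move=> bf; rewrite tlift_pi// big_seq1. Qed.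

Lemma tpure_bilinear : bilinear_map tpure.
Proof.
split=> [w a v v'|v a w w']; apply: tensor_eqP => U f bf;
  rewrite (tlift_linear bf) !tliftE//.
- exact: (bf.1 w).
- exact: (bf.2 v).
Qed.

Lemma tpureDl v v' w : (v + v') \ot w = v \ot w + v' \ot w.
Proof. by have := tpure_bilinear.1 w 1 v v'; rewrite /= !scale1r. Qed.
Lemma tpureDr v w w' : v \ot (w + w') = v \ot w + v \ot w'.
Proof. by have := tpure_bilinear.2 v 1 w w'; rewrite /= !scale1r. Qed.
Lemma tpureZl a v w : (a *: v) \ot w = a *: (v \ot w).
Proof. exact: (scalable_linear (tpure_bilinear.1 w)). Qed.
Lemma tpureZr a v w : v \ot (a *: w) = a *: (v \ot w).
Proof. exact: (scalable_linear (tpure_bilinear.2 v)). Qed.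
Lemma tpure0l w : 0 \ot w = 0.
Proof. by rewrite -[0 in LHS](scale0r 0) tpureZl scale0r. Qed.
Lemma tpure0r v : v \ot 0 = 0.
Proof. by rewrite -[0 in LHS](scale0r 0) tpureZr scale0r. Qed.

Lemma tensorE (x : tensor) : x = \sum_(p <- tensor_repr x) p.1 \ot p.2.
Proof.
apply: tensor_eqP => U f bf.
pose g := linear_pack (tlift_linear bf).
rewrite -[tlift f in RHS]/(g : _ -> _) linear_sum /= {1}/tlift.
by apply: eq_bigr => p _; rewrite tliftE.
Qed.

Lemma tensor_linear_ext (U : lmodType K) (g h : {linear tensor -> U}) :
  (forall v w, g (v \ot w) = h (v \ot w)) -> g =1 h.
Proof.
by move=> gh x; rewrite [x]tensorE !linear_sum; apply: eq_bigr => p _; exact: gh.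
Qed.

End Tensor.

Notation "v \ot w" := (tpure v w) : ring_scope.

(* The degrees in Z/2 are booleans: false is even, true is odd, and the
   addition is the exclusive or, written (+). *)
HB.mixin Record Lmodule_isSuper (K : fieldType) V of GRing.Lmodule K V := {
  homog : bool -> set V;
  homog0 : forall d, homog d 0;
  homogP : forall d a u v, homog d u -> homog d v -> homog d (a *: u + v);
  homog_split : forall v, exists c : bool -> V,
    (forall d, homog d (c d)) /\ v = \sum_(d : bool) c d;
  homog_direct : forall v, homog false v -> homog true v -> v = 0
}.

#[short(type="superModType")]
HB.structure Definition SuperModule (K : fieldType) :=
  {V of GRing.Lmodule K V & Lmodule_isSuper K V}.

Section SuperModuleTheory.
Context (K : fieldType) (V : superModType K).
Implicit Types (u v : V) (d : bool).

Definition hcomp d v : V := projT1 (cid (homog_split v)) d.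

Lemma homog_hcomp d v : homog d (hcomp d v).
Proof. by rewrite /hcomp; case: cid => c /= []. Qed.

Lemma hcomp_sum v : v = \sum_(d : bool) hcomp d v.
Proof. by rewrite /hcomp; case: cid => c /= []. Qed.

Lemma homogD d u v : homog d u -> homog d v -> homog d (u + v).
Proof. by move=> du dv; rewrite -[u]scale1r; exact: homogP. Qed.

Lemma homogZ d a v : homog d v -> homog d (a *: v).
Proof. by move=> dv; rewrite -[_ *: v]addr0; apply: homogP => //; exact: homog0. Qed.

Lemma homog_sum d I (r : seq I) (P : pred I) (F : I -> V) :
  (forall i, P i -> homog d (F i)) -> homog d (\sum_(i <- r | P i) F i).
Proof.
by move=> PF; elim/big_ind: _ => //; [exact: homog0 | exact: homogD].
Qed.

Lemma hcomp_uniq (c : bool -> V) v :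
  (forall d, homog d (c d)) -> v = \sum_(d : bool) c d -> forall d, hcomp d v = c d.
Proof.
move=> cd vE; pose e d := hcomp d v - c d.
have he d : homog d (e d).
  by rewrite /e addrC -scaleN1r; apply: homogP => //; exact: homog_hcomp.
have e0 : e true + e false = 0.
  by have := hcomp_sum v; rewrite {1}vE !big_bool /e addrACA -opprD => ->; rewrite subrr.
have et : e true = 0.
  apply: homog_direct => //.
  have -> : e true = - e false by apply/eqP; rewrite -addr_eq0 e0.
  by rewrite -scaleN1r; exact: homogZ.
have ef : e false = 0 by move: e0; rewrite et add0r.
by move=> d; apply/eqP; rewrite -subr_eq0 -/(e d); case: d; rewrite ?et ?ef.
Qed.

Lemma hcomp_is_linear d : linear (hcomp d).
Proof.
move=> a u v; apply: (hcomp_uniq (c := fun d => a *: hcomp d u + hcomp d v)).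
  by move=> {}d; apply: homogP; exact: homog_hcomp.
by rewrite big_split -scaler_sumr -!hcomp_sum.
Qed.

HB.instance Definition _ d :=
  GRing.isLinear.Build K V V *:%R (hcomp d) (hcomp_is_linear d).

Lemma hcomp_homog d e v : homog e v -> hcomp d v = if d == e then v else 0.
Proof.
move=> ev; apply: (hcomp_uniq (c := fun d => if d == e then v else 0)).
  by move=> {}d; case: eqP => [->//|_]; exact: homog0.
by rewrite big_bool; case: (e) => /=; rewrite ?addr0 ?add0r.
Qed.

End SuperModuleTheory.

(* The ground field is purely even. *)
Section GroundField.
Context (K : fieldType).

Let ghomog (d : bool) : set K^o := [set a | d -> a = 0].

Let ghomog0 d : ghomog d 0. Proof. by []. Qed.
Let ghomogP d (a : K) u v : ghomog d u -> ghomog d v -> ghomog d (a *: u + v).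
Proof. by move=> du dv hd; rewrite du// dv// scaler0 addr0. Qed.
Let ghomog_split (v : K^o) : exists c : bool -> K^o,
  (forall d, ghomog d (c d)) /\ v = \sum_(d : bool) c d.
Proof.
exists (fun d => if d then 0 else v); split=> [[]//|].
by rewrite big_bool /= add0r.
Qed.
Let ghomog_direct v : ghomog false v -> ghomog true v -> v = 0.
Proof. by move=> _; apply. Qed.

HB.instance Definition _ := Lmodule_isSuper.Build K K^o
  ghomog0 ghomogP ghomog_split ghomog_direct.

End GroundField.

Section HomSuper.
Context (K : fieldType) (V W : superModType K).

Let hhomog (d : bool) : set {linear V -> W} :=
  [set f : {linear V -> W} | forall p v, homog p v -> homog (p (+) d) (f v)].

Let hhomog0 d : hhomog d 0. Proof. by move=> p v _; exact: homog0. Qed.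
Let hhomogP d (a : K) f g : hhomog d f -> hhomog d g -> hhomog d (a *: f + g).
Proof. by move=> df dg p v pv; apply: homogP; [exact: df | exact: dg]. Qed.

Let part (f : {linear V -> W}) (d : bool) (v : V) : W :=
  \sum_(p : bool) hcomp (p (+) d) (f (hcomp p v)).

Let part_is_linear f d : linear (part f d).
Proof.
move=> a u v; rewrite /part scaler_sumr -big_split; apply: eq_bigr => p _.
by rewrite !linearP.
Qed.

Let hhomog_split (f : {linear V -> W}) : exists c : bool -> {linear V -> W},
  (forall d, hhomog d (c d)) /\ f = \sum_(d : bool) c d.
Proof.
exists (fun d => linear_pack (part_is_linear f d)); split.
  move=> d p v pv /=; apply: homog_sum => q _.
  rewrite (hcomp_homog _ pv); case: eqP => [->|_]; first exact: homog_hcomp.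
  by rewrite !linear0; exact: homog0.
apply: linear_ext => v; rewrite big_bool homDE /= /part !big_bool /=.
rewrite {1}(hcomp_sum v) big_bool linearD.
rewrite {1}[f (hcomp true v)]hcomp_sum {1}[f (hcomp false v)]hcomp_sum !big_bool/=.
by rewrite [X in X + _ = _]addrC addrACA.
Qed.

Let hhomog_direct f : hhomog false f -> hhomog true f -> f = 0.
Proof.
move=> f0 f1; apply: linear_ext => v; rewrite [v]hcomp_sum linear_sum hom0E.
rewrite big1// => p _.
have := f0 p _ (homog_hcomp p v); have := f1 p _ (homog_hcomp p v).
by case: p => /= h1 h2; apply: homog_direct.
Qed.

HB.instance Definition _ := Lmodule_isSuper.Build K {linear V -> W}
  hhomog0 hhomogP hhomog_split hhomog_direct.

End HomSuper.

Section TensorSuper.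
Context (K : fieldType) (V W : superModType K).

(* The component of degree d is spanned by the v \ot w with v and w homogeneous
   and [v] + [w] = d. *)
Let thomog (d : bool) : set (tensor V W) := [set x | exists s : seq (bool * (V * W)),
  (forall p v w, (p, (v, w)) \in s -> homog p v /\ homog (p (+) d) w) /\
  x = \sum_(t <- s) t.2.1 \ot t.2.2].

Let thomog0 d : thomog d 0.
Proof. by exists [::]; rewrite big_nil. Qed.
Let thomogP d (a : K) x y : thomog d x -> thomog d y -> thomog d (a *: x + y).
Proof.
move=> [s [hs ->]] [t [ht ->]].
exists ([seq (z.1, (a *: z.2.1, z.2.2)) | z <- s] ++ t); split.
  move=> p v w; rewrite mem_cat => /orP[/mapP[[q [v' w']] /hs[qv qw] [-> -> ->]]|/ht//].
  by split=> //; exact: homogZ.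
rewrite big_cat big_map scaler_sumr; congr (_ + _); apply: eq_bigr => z _ /=.
by rewrite tpureZl.
Qed.

Let tcomp_fun (d : bool) (v : V) (w : W) : tensor V W :=
  \sum_(p : bool) hcomp p v \ot hcomp (p (+) d) w.

Let tcomp_bilinear d : bilinear_map (tcomp_fun d).
Proof.
split=> [w a v v'|v a w w']; rewrite /tcomp_fun /= scaler_sumr -big_split;
  apply: eq_bigr => p _; rewrite linearP.
- exact: ((tpure_bilinear V W).1 _).
- exact: ((tpure_bilinear V W).2 _).
Qed.

Let tcomp d : {linear tensor V W -> tensor V W} :=
  linear_pack (tlift_linear (tcomp_bilinear d)).

Let tcomp_homog d x : thomog d (tcomp d x).
Proof.
rewrite [x]tensorE linear_sum; elim/big_ind: _ => [|y z hy hz|[v w] _].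
- exact: thomog0.
- by rewrite -[y]scale1r; exact: thomogP.
rewrite /= tliftE; last exact: tcomp_bilinear.
exists [seq (p, (hcomp p v, hcomp (p (+) d) w)) | p <- [:: true; false]].
split; last by rewrite big_map /tcomp_fun big_bool !big_cons big_nil addr0.
by move=> p v' w'; rewrite !inE => /orP[]/eqP[-> -> ->]; split; exact: homog_hcomp.
Qed.

Let tcomp_sum x : x = \sum_(d : bool) tcomp d x.
Proof.
have -> : \sum_d tcomp d x = (\sum_(d : bool) tcomp d) x by rewrite !big_bool.
rewrite -[LHS]/(idfun x); apply: tensor_linear_ext => v w.
rewrite big_bool homDE /= !tliftE; do ?exact: tcomp_bilinear.
rewrite /tcomp_fun !big_bool /= {1}[v]hcomp_sum big_bool.
rewrite tpureDl {1 2}[w]hcomp_sum !big_bool !tpureDr.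
by rewrite [X in X + _ = _]addrC addrACA.
Qed.

Let tcompE d e x : thomog e x -> tcomp d x = if d == e then x else 0.
Proof.
move=> [s [hs ->]]; rewrite linear_sum.
have -> (y : tensor V W) : (if d == e then y else 0) = (d == e)%:R *: y.
  by case: eqP; rewrite ?scale1r ?scale0r.
rewrite scaler_sumr big_seq [RHS]big_seq; apply: eq_bigr => -[p [v w]] /hs[pv ew] /=.
rewrite tliftE; last exact: tcomp_bilinear.
rewrite /tcomp_fun big_bool !(hcomp_homog _ pv) !(hcomp_homog _ ew).
by case: p d e {pv ew hs} => -[] [] /=; rewrite ?tpure0l ?tpure0r ?scale0r ?scale1r ?add0r ?addr0.
Qed.

Let thomog_split x : exists c : bool -> tensor V W,
  (forall d, thomog d (c d)) /\ x = \sum_(d : bool) c d.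
Proof. by exists (tcomp^~ x); split=> [d|]; [exact: tcomp_homog|exact: tcomp_sum]. Qed.

Let thomog_direct x : thomog false x -> thomog true x -> x = 0.
Proof.
by move=> x0 x1; have := tcompE true x1; rewrite (tcompE true x0) eqxx.
Qed.

HB.instance Definition _ := Lmodule_isSuper.Build K (tensor V W)
  thomog0 thomogP thomog_split thomog_direct.

End TensorSuper.

Section TensorMap.
Context (K : fieldType) (V V' W W' : superModType K).
Context (f : {linear V -> V'}) (g : {linear W -> W'}).

(* (f (x) g)(v (x) w) = (-1)^([g][v]) f(v) (x) g(w), extended to non-homogeneous
   g and v by decomposing both into their homogeneous components. *)
Definition tmap_fun (v : V) (w : W) : tensor V' W' :=
  \sum_(p : bool) \sum_(q : bool)
    (-1) ^+ (p && q) *: (f (hcomp q v) \ot hcomp p g w).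

Definition tmap : tensor V W -> tensor V' W' := tlift tmap_fun.

Lemma tmap_bilinear : bilinear_map tmap_fun.
Proof.
split=> [w a v v'|v a w w']; rewrite /tmap_fun /= scaler_sumr -big_split;
  apply: eq_bigr => p _; rewrite scaler_sumr -big_split; apply: eq_bigr => q _ /=.
- by rewrite !linearP tpureDl tpureZl scalerDr !scalerA mulrC.
- by rewrite linearP tpureDr tpureZr scalerDr !scalerA mulrC.
Qed.

HB.instance Definition _ := GRing.isLinear.Build K (tensor V W) (tensor V' W') *:%R
  tmap (tlift_linear tmap_bilinear).

Lemma tmapE p q v w : homog p g -> homog q v ->
  tmap (v \ot w) = (-1) ^+ (p && q) *: (f v \ot g w).
Proof.
move=> gp vq; rewrite /tmap tliftE; last exact: tmap_bilinear.
rewrite /tmap_fun !big_bool !(hcomp_homog _ gp) !(hcomp_homog _ vq).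
case: p q {gp vq} => -[] /=;
  by rewrite ?linear0 ?hom0E ?tpure0l ?tpure0r ?scaler0 ?add0r ?addr0.
Qed.

End TensorMap.

Lemma tmap_linearr (K : fieldType) (V V' W W' : superModType K)
    (f : {linear V -> V'}) (a : K) (g h : {linear W -> W'}) x :
  tmap f (a *: g + h) x = a *: tmap f g x + tmap f h x.
Proof.
rewrite /tmap /tlift scaler_sumr -big_split; apply: eq_bigr => -[v w] _ /=.
rewrite /tmap_fun scaler_sumr -big_split; apply: eq_bigr => p _ /=.
rewrite scaler_sumr -big_split; apply: eq_bigr => q _ /=.
by rewrite linearP tpureDr tpureZr scalerDr !scalerA mulrC.
Qed.

Section TensorAssoc.
Context (K : fieldType) (U V W : lmodType K).

Definition tassoc : tensor (tensor U V) W -> tensor U (tensor V W) :=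
  tlift (fun x w => tlift (fun u v => u \ot (v \ot w)) x).

Let tassoc_fun_bilinear (w : W) : bilinear_map (fun (u : U) (v : V) => u \ot (v \ot w)).
Proof.
split=> [v a u u'|u a v v'] /=; first by rewrite tpureDl tpureZl.
by rewrite tpureDl tpureZl tpureDr tpureZr.
Qed.

Lemma tassoc_bilinear : bilinear_map
  (fun (x : tensor U V) (w : W) => tlift (fun u v => u \ot (v \ot w)) x).
Proof.
split=> [w|x a w w'] /=; first exact: tlift_linear.
rewrite /tlift scaler_sumr -big_split; apply: eq_bigr => p _ /=.
by rewrite !tpureDr !tpureZr.
Qed.

HB.instance Definition _ :=
  GRing.isLinear.Build K (tensor (tensor U V) W) (tensor U (tensor V W)) *:%R
    tassoc (tlift_linear tassoc_bilinear).

Lemma tassocE (u : U) (v : V) (w : W) : tassoc ((u \ot v) \ot w) = u \ot (v \ot w).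
Proof. by rewrite /tassoc tliftE ?tliftE//; exact: tassoc_bilinear. Qed.

End TensorAssoc.

HB.mixin Record Algebra_isSuper (K : fieldType) A
    of GRing.Algebra K A & SuperModule K A := {
  homog1 : homog false (1 : A);
  homogM : forall p q (a b : A), homog p a -> homog q b -> homog (p (+) q) (a * b)
}.

#[short(type="superAlgType")]
HB.structure Definition SuperAlgebra (K : fieldType) :=
  {A of GRing.Algebra K A & SuperModule K A & Algebra_isSuper K A}.

Section TensorAlgebra.
Context (K : fieldType) (A : superAlgType K).

Definition mult : tensor A A -> A := tlift (fun a b => a * b).

Lemma mult_bilinear : bilinear_map (fun a b : A => a * b).
Proof.
split=> [b c a a'|a c b b'] /=; first by rewrite mulrDl scalerAl.
by rewrite mulrDr scalerAr.
Qed.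

HB.instance Definition _ :=
  GRing.isLinear.Build K (tensor A A) A *:%R mult (tlift_linear mult_bilinear).

Lemma multE a b : mult (a \ot b) = a * b.
Proof. by rewrite /mult tliftE; last exact: mult_bilinear. Qed.

(* The product of A (x) A: (a (x) b)(c (x) d) = (-1)^([b][c]) ac (x) bd. *)
Definition tensor_mul_fun (a b c d : A) : tensor A A :=
  \sum_(p : bool) \sum_(q : bool)
    (-1) ^+ (p && q) *: ((a * hcomp q c) \ot (hcomp p b * d)).

Definition tensor_mul (x y : tensor A A) : tensor A A :=
  tlift (fun a b => tlift (tensor_mul_fun a b) y) x.

Lemma tensor_mul_funr a b : bilinear_map (tensor_mul_fun a b).
Proof.
split=> [d k c c'|c k d d']; rewrite /tensor_mul_fun /= scaler_sumr -big_split;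
  apply: eq_bigr => p _; rewrite scaler_sumr -big_split; apply: eq_bigr => q _ /=.
- by rewrite linearP mulrDr -scalerAr tpureDl tpureZl scalerDr !scalerA mulrC.
- by rewrite mulrDr -scalerAr tpureDr tpureZr scalerDr !scalerA mulrC.
Qed.

Lemma tensor_mul_funl y : bilinear_map (fun a b => tlift (tensor_mul_fun a b) y).
Proof.
split=> [b k a a'|a k b b']; rewrite /tlift /= scaler_sumr -big_split;
  apply: eq_bigr => -[c d] _ /=; rewrite /tensor_mul_fun scaler_sumr -big_split;
  apply: eq_bigr => p _; rewrite scaler_sumr -big_split; apply: eq_bigr => q _ /=.
- by rewrite mulrDl -scalerAl tpureDl tpureZl scalerDr !scalerA mulrC.
- by rewrite linearP mulrDl -scalerAl tpureDr tpureZr scalerDr !scalerA mulrC.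
Qed.

Lemma tensor_mulE p q a b c d : homog p b -> homog q c ->
  tensor_mul (a \ot b) (c \ot d) = (-1) ^+ (p && q) *: ((a * c) \ot (b * d)).
Proof.
move=> bp cq; rewrite /tensor_mul tliftE; last exact: tensor_mul_funl.
rewrite tliftE; last exact: tensor_mul_funr.
rewrite /tensor_mul_fun !big_bool !(hcomp_homog _ bp) !(hcomp_homog _ cq).
by case: p q {bp cq} => -[] /=;
  rewrite ?mulr0 ?mul0r ?tpure0l ?tpure0r ?scaler0 ?add0r ?addr0.
Qed.

End TensorAlgebra.

HB.mixin Record SuperAlgebra_isHopf (K : fieldType) A of SuperAlgebra K A := {
  comul : {linear A -> tensor A A};
  counit : {linear A -> K^o};
  antipode : {linear A -> A};
  comul_even : homog false comul;
  counit_even : homog false counit;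
  antipode_even : homog false antipode;
  comulA : forall a, tassoc (tmap comul idfun (comul a)) = tmap idfun comul (comul a);
  counitl : forall a, tmap counit idfun (comul a) = (1 : K^o) \ot a;
  counitr : forall a, tmap idfun counit (comul a) = a \ot (1 : K^o);
  comul1 : comul 1 = 1 \ot 1;
  comulM : forall a b, comul (a * b) = tensor_mul (comul a) (comul b);
  counit1 : counit 1 = 1;
  counitM : forall a b, counit (a * b) = counit a * counit b;
  antipodel : forall a, mult (tmap antipode idfun (comul a)) = counit a *: 1;
  antipoder : forall a, mult (tmap idfun antipode (comul a)) = counit a *: 1
}.

#[short(type="hopfSuperAlgType")]
HB.structure Definition HopfSuperAlgebra (K : fieldType) :=
  {A of SuperAlgebra K A & SuperAlgebra_isHopf K A}.

Section Integrals.
Context (K : fieldType) (A : hopfSuperAlgType K).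

(* The value 1_A I(a) is read in A (x) K, respectively K (x) A, instead of being
   transported to A. *)
Definition left_integral : set {linear A -> K^o} :=
  [set I | forall a, tmap idfun I (comul a) = 1 \ot I a].

Definition right_integral : set {linear A -> K^o} :=
  [set I | forall a, tmap I idfun (comul a) = I a \ot 1].

Lemma left_integral0 : left_integral 0.
Proof.
move=> a; have := tmap_linearr idfun (-1) (0 : {linear A -> K^o}) 0 (comul a).
by rewrite scaler0 addr0 scaleN1r addNr hom0E tpure0r.
Qed.

Lemma left_integralP (c : K) I J : left_integral I -> left_integral J ->
  left_integral (c *: I + J).
Proof.
by move=> hI hJ a; rewrite tmap_linearr hI hJ homDE homZE tpureDr tpureZr.
Qed.

End Integrals.

Definition is_basis (K : fieldType) (V : lmodType K) (E : set V) n (e : 'I_n -> V) :=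
  [/\ forall i, E (e i),
      forall c : 'I_n -> K, \sum_(i < n) c i *: e i = 0 -> forall i, c i = 0 &
      forall v, E v -> exists c : 'I_n -> K, v = \sum_(i < n) c i *: e i].

(* Only meaningful for E a subspace of V. *)
Definition has_dim (K : fieldType) (V : lmodType K) (E : set V) (n : nat) :=
  exists e : 'I_n -> V, is_basis E e.

(* Main.v *)
Require Import Defs.
From mathcomp Require Import all_boot all_algebra all_classical reals.
Local Open Scope ring_scope.

Set Implicit Arguments.
Unset Strict Implicit.
Unset Printing Implicit Defensive.

Import GRing.Theory.

(** Write a_1 (x) a_2 for the coproduct of a, S for the antipode, e for the
    counit, and pi_0, pi_1 for the projections on the even and odd parts.

    Since a_1 phi(a_2) = phi(a) 1 only pairs phi with the part of a_2 of its own
    degree, comparing degrees shows that both homogeneous components of an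
    integral are integrals, and satisfy the defining identity without any sign
    ([left_integral_components], [right_integral_components]). Signs are then
    left in a single place, the coproduct of a product:
      Delta(ab) = sum_(i,j) (-1)^(ij) a_1 pi_j(b_1) (x) pi_i(a_2) b_2.
    The record [signed_hopf] keeps this rule and the unsigned axioms. It is
    stable under reversing both the product and the coproduct ([mirror]), which
    exchanges left and right integrals, so only left integrals are studied.

    Let phi be a nonzero left integral. Up to signs:
    - S(a_1) phi(a_2 b) = b_1 phi(a b_2)  ([left_int_shift]);
    - if phi(a x) = 0 for all a then x = 0  ([left_int_nondegenerate]): the set M
      of such x is a left ideal, and a left coideal by the shift formula, hence
      e(x) 1 = S(x_1) x_2 is in M for x in M; as phi is nonzero, e vanishes on M,
      and so does x = x_1 e(x_2);
    - if theta is a homogeneous left integral, then theta o S is a right integral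
      ([left_int_antipode]).
    Apply theta to the shift formula and put f(b) = theta(b_1) b_2. This gives
      phi(a f(b)) = theta(S(a_1)) phi(a_2 b) = theta(S(a)) phi(b).
    Hence phi(z) f(b) - phi(b) f(z) is in M, so it is 0, and the counit
    yields phi(z) theta(b) = phi(b) theta(z): theta is a multiple of phi
    ([left_int_proportional]).

    Applied to the components theta = phi o pi_i of an arbitrary integral phi,
    this says that both are multiples of phi. If phi is nonzero, one of them,
    say phi o pi_t, is a nonzero multiple c phi; as pi_t pi_i = 0 for i != t, phi
    vanishes on the other part and is homogeneous of degree t. All left integrals
    being homogeneous, any two of them are proportional. *)

(** * Bilinear maps and finite sums of tensors *)

Section Multilinear.
Context (K : fieldType).
Implicit Types U V W : lmodType K.

Lemma scalePl V k (c d : K^o) (v : V) : (k *: c + d) *: v = k *: (c *: v) + d *: v.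
Proof. by rewrite scalerDl scalerA. Qed.

Lemma scalePr V (k c : K) (u v : V) : c *: (k *: u + v) = k *: (c *: u) + c *: v.
Proof. by rewrite scalerDr !scalerA mulrC. Qed.

Lemma formZ V (phi : {linear V -> K^o}) (k : K) v : phi (k *: v) = k * phi v.
Proof. exact: linearZ. Qed.

Lemma sumP V I (r : seq I) k (F G : I -> V) :
  \sum_(i <- r) (k *: F i + G i) = k *: \sum_(i <- r) F i + \sum_(i <- r) G i.
Proof. by rewrite big_split scaler_sumr. Qed.

Lemma linear_sumF V U I (r : seq I) (f : I -> V -> U) :
  (forall i, linear (f i)) -> linear (fun x => \sum_(i <- r) f i x).
Proof. by move=> lf k x y; rewrite -sumP; apply: eq_bigr => i _; apply: lf. Qed.

Lemma bilinear_sumF V W U I (r : seq I) (f : I -> V -> W -> U) :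
  (forall i, bilinear_map (f i)) -> bilinear_map (fun x y => \sum_(i <- r) f i x y).
Proof.
by move=> bf; split=> [y|x]; apply: linear_sumF => i; [apply: (bf i).1|apply: (bf i).2].
Qed.

Lemma lin_sum V U (f : V -> U) I (r : seq I) (F : I -> V) : linear f ->
  f (\sum_(i <- r) F i) = \sum_(i <- r) f (F i).
Proof. by move=> lf; exact: (linear_sum (linear_pack lf)). Qed.

Section Bilinear.
Context V W U (B : V -> W -> U) (bB : bilinear_map B).

Lemma bilZl k x y : B (k *: x) y = k *: B x y.
Proof. exact: (scalable_linear (bB.1 y)). Qed.
Lemma bilZr k x y : B x (k *: y) = k *: B x y.
Proof. exact: (scalable_linear (bB.2 x)). Qed.
Lemma bil_suml I (r : seq I) F y : B (\sum_(i <- r) F i) y = \sum_(i <- r) B (F i) y.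
Proof. exact: (linear_sum (linear_pack (bB.1 y))). Qed.
Lemma bil_sumr I (r : seq I) F x : B x (\sum_(i <- r) F i) = \sum_(i <- r) B x (F i).
Proof. exact: (linear_sum (linear_pack (bB.2 x))). Qed.
Lemma bil0l y : B 0 y = 0.
Proof. exact: (linear0 (linear_pack (bB.1 y))). Qed.
Lemma bil0r x : B x 0 = 0.
Proof. exact: (linear0 (linear_pack (bB.2 x))). Qed.
Lemma bilBr x y z : B x (y - z) = B x y - B x z.
Proof. exact: (linearB (linear_pack (bB.2 x))). Qed.

End Bilinear.

Definition trilinear V1 V2 V3 U (f : V1 -> V2 -> V3 -> U) :=
  [/\ forall y z, linear (fun x => f x y z), forall x z, linear (fun y => f x y z)
    & forall x y, linear (f x y)].

End Multilinear.

(** Let M be the common kernel of the forms [g j]. The hypothesis says that the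
    tensor [s] is killed by all the id (x) [g j]; then it is in V (x) M, which is
    what the conclusion expresses, tested on maps vanishing on V x M. As there
    may be infinitely many forms, the argument is an induction on the length of
    [s]: a term [(u, v)] with [v] outside M has [g j v != 0] for some [j], which
    expresses [u] through the other terms and makes it possible to eliminate it. *)
Lemma sum_bilinear_ker (K : fieldType) (V W U : lmodType K) (J : Type)
    (g : J -> {linear W -> K^o}) (b : V -> W -> U) (s : seq (V * W)) :
  bilinear_map b -> (forall u v, (forall j, g j v = 0) -> b u v = 0) ->
  (forall j, \sum_(p <- s) g j p.2 *: p.1 = 0) ->
  \sum_(p <- s) b p.1 p.2 = 0.
Proof.
move=> bB bM; elim: {s}(size s) {-2}s (erefl (size s)) => [|n IHn] s.
  by move/size0nil=> ->; rewrite big_nil.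
case: s => [//|[u v] s] [sz] gs.
have [gv|/existsNP[j gv]] := pselect (forall j, g j v = 0).
  rewrite big_cons bM// add0r; apply: IHn => // j.
  by move: (gs j); rewrite big_cons gv scale0r add0r.
have {}gv : g j v != 0 by apply/eqP.
pose c (p : V * W) : K := - ((g j v)^-1 * g j p.2).
have uE : u = \sum_(p <- s) c p *: p.1.
  have := gs j; rewrite big_cons /= => /eqP; rewrite addr_eq0 => /eqP.
  move=> /(congr1 (fun x => (g j v)^-1 *: x)); rewrite scalerA mulVf// scale1r => ->.
  rewrite scalerN scaler_sumr -sumrN; apply: eq_bigr => p _.
  by rewrite scalerA scaleNr.
have E0 : \sum_(p <- [seq (p.1, c p *: v + p.2) | p <- s]) b p.1 p.2 = 0.
  apply: IHn => [|k]; rewrite ?size_map// big_map.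
  have := gs k; rewrite big_cons /= {1}uE scaler_sumr -big_split => gk.
  rewrite -[RHS]gk; apply: eq_bigr => p _ /=.
  by rewrite linearP scalePl !scalerA mulrC.
rewrite -[RHS]E0 big_cons big_map /= {1}uE (bil_suml bB) -big_split /=.
by apply: eq_bigr => p _ /=; rewrite (bilZl bB) bB.2.
Qed.

(** * Hopf algebras with signs in the product rule only *)

(** A coproduct is a list of pairs representing a tensor, and identities between
    tensors are tested on multilinear maps: every axiom is then an equality of
    finite sums, and the reversed structure is obtained by swapping the pairs.
    The projections [spi] on the even and odd parts express the sign in [scopM]. *)
Record signed_hopf (K : fieldType) (V : lmodType K) := SignedHopf {
  smul : V -> V -> V;
  sone : V;
  seps : {linear V -> K^o};
  sant : {linear V -> V};
  spi : bool -> {linear V -> V};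
  scop : V -> seq (V * V);
  smul_bilinear : bilinear_map smul;
  smulA : associative smul;
  smul1l : left_id sone smul;
  smul1r : right_id sone smul;
  spiK : forall i j x, spi i (spi j x) = if i == j then spi i x else 0;
  spi_sum : forall x, \sum_(i : bool) spi i x = x;
  spi1 : spi false sone = sone;
  scop_linear : forall (U : lmodType K) (f : V -> V -> U), bilinear_map f ->
    linear (fun a => \sum_(p <- scop a) f p.1 p.2);
  scopA : forall (U : lmodType K) (f : V -> V -> V -> U), trilinear f -> forall a,
    \sum_(p <- scop a) \sum_(q <- scop p.1) f q.1 q.2 p.2 =
    \sum_(p <- scop a) \sum_(q <- scop p.2) f p.1 q.1 q.2;
  scounitl : forall a, \sum_(p <- scop a) seps p.1 *: p.2 = a;
  scounitr : forall a, \sum_(p <- scop a) seps p.2 *: p.1 = a;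
  santl : forall a, \sum_(p <- scop a) smul (sant p.1) p.2 = seps a *: sone;
  santr : forall a, \sum_(p <- scop a) smul p.1 (sant p.2) = seps a *: sone;
  scop1 : forall (U : lmodType K) (f : V -> V -> U), bilinear_map f ->
    \sum_(p <- scop sone) f p.1 p.2 = f sone sone;
  scopM : forall (U : lmodType K) (f : V -> V -> U), bilinear_map f -> forall a b,
    \sum_(p <- scop (smul a b)) f p.1 p.2 =
    \sum_(p <- scop a) \sum_(q <- scop b) \sum_(i : bool) \sum_(j : bool)
      (-1) ^+ (i && j) *: f (smul p.1 (spi j q.1)) (smul (spi i p.2) q.2)
}.

(** * Left integrals are proportional *)

Section Uniqueness.
Context (K : fieldType) (V : lmodType K) (H : signed_hopf V).
Implicit Types (a b c x y z : V) (phi theta : {linear V -> K^o}).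

Local Notation "x ** y" := (smul H x y) (at level 40, left associativity).
Local Notation one := (sone H).
Local Notation S := (sant H).
Local Notation eps := (seps H).
Local Notation pi := (spi H).
Local Notation cop := (scop H).

(** The map multiplying a homogeneous [x] by (-1)^(t[x]). *)
Definition sgn (t : bool) : {linear V -> V} := \sum_(i : bool) (-1) ^+ (i && t) *: pi i.

Lemma sgnE t x : sgn t x = \sum_(i : bool) (-1) ^+ (i && t) *: pi i x.
Proof. by rewrite /sgn !big_bool. Qed.

Lemma sgnK t : involutive (sgn t).
Proof.
move=> x; rewrite [sgn t x]sgnE linear_sum -[RHS](spi_sum H); apply: eq_bigr => i _.
rewrite linearZ sgnE (bigD1 i)//= big1 ?addr0.
  by rewrite spiK eqxx scalerA -expr2 sqrr_sign scale1r.
by move=> j /negPf ji; rewrite spiK ji scaler0.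
Qed.

Lemma sgn1 t : sgn t one = one.
Proof.
rewrite sgnE big_bool /= spi1 expr0 scale1r -[X in pi true X](spi1 H) spiK /=.
by rewrite scaler0 add0r.
Qed.

Lemma mulPl k x y z : (k *: x + y) ** z = k *: (x ** z) + y ** z.
Proof. exact: (smul_bilinear H).1. Qed.
Lemma mulPr k x y z : z ** (k *: x + y) = k *: (z ** x) + z ** y.
Proof. exact: (smul_bilinear H).2. Qed.

Let mulb := smul_bilinear H.

(* Multilinearity of an expression built from products and linear maps. *)
Ltac mlin := repeat match goal with |- _ = _ => fail 1 | _ => first [intro | split] end;
  rewrite /= ?(mulPl, mulPr, linearP, scalePl, scalePr) /=; by [].

Lemma copM (U : lmodType K) (f : V -> V -> U) a b : bilinear_map f ->
  \sum_(p <- cop (a ** b)) f p.1 p.2 =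
  \sum_(p <- cop a) \sum_(q <- cop b) \sum_(i : bool)
    f (p.1 ** sgn i q.1) (pi i p.2 ** q.2).
Proof.
move=> bf; rewrite scopM//; do 3![apply: eq_bigr => ? _].
rewrite sgnE (bil_sumr mulb) (bil_suml bf); apply: eq_bigr => j _.
by rewrite (bilZr mulb) (bilZl bf) andbC.
Qed.

Lemma antipode_cancel_ll (U : lmodType K) (B : V -> V -> U) a : bilinear_map B ->
  \sum_(p <- cop a) \sum_(q <- cop p.2) B (S p.1 ** q.1) q.2 = B one a.
Proof.
move=> bB; rewrite -(scopA H (f := fun x y z => B (S x ** y) z)); last first.
  split=> [y z|x z|x y] k u v; rewrite ?linearP ?(mulPl, mulPr) ?bB.1//.
  exact: bB.2.
rewrite -{2}[a](scounitl H) (bil_sumr bB); apply: eq_bigr => p _.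
by rewrite -(bil_suml bB) santl (bilZl bB) (bilZr bB).
Qed.

Lemma antipode_cancel_rl (U : lmodType K) (B : V -> V -> U) a : bilinear_map B ->
  \sum_(p <- cop a) \sum_(q <- cop p.1) B (q.1 ** S q.2) p.2 = B one a.
Proof.
move=> bB; rewrite -{2}[a](scounitl H) (bil_sumr bB); apply: eq_bigr => p _.
by rewrite -(bil_suml bB) santr (bilZl bB) (bilZr bB).
Qed.

Lemma antipode_cancel_rr (U : lmodType K) (B : V -> V -> U) a : bilinear_map B ->
  \sum_(p <- cop a) \sum_(q <- cop p.1) B q.1 (q.2 ** S p.2) = B a one.
Proof.
move=> bB; rewrite (scopA H (f := fun x y z => B x (y ** S z))); last first.
  split=> [y z|x z|x y] k u v; rewrite ?linearP ?(mulPl, mulPr) ?bB.2//.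
  exact: bB.1.
rewrite -{2}[a](scounitr H) (bil_suml bB); apply: eq_bigr => p _.
by rewrite -(bil_sumr bB) santr (bilZl bB) (bilZr bB).
Qed.

Definition left_int (phi : V -> K^o) :=
  forall a, \sum_(p <- cop a) phi p.2 *: p.1 = phi a *: one.

(** The integral identity for [p.2 ** b], multiplied on the left by [S p.1]: its
    left side is S(a_1) a_2 b_1 phi(a_3 b_2), where the antipode cancels a_1
    against a_2. The sign depends on the degree of what multiplies [b] inside
    [phi], that is, of [a] after the cancellation. *)
Lemma left_int_shift phi a b : left_int phi ->
  \sum_(p <- cop a) phi (p.2 ** b) *: S p.1 =
  \sum_(i : bool) sgn i (\sum_(q <- cop b) phi (pi i a ** q.2) *: q.1).
Proof.
move=> iphi.
pose W x := \sum_(i : bool) sgn i (\sum_(q <- cop b) phi (pi i x ** q.2) *: q.1).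
have lW : linear W.
  apply: linear_sumF => i k x y; rewrite -linearP; congr (sgn i _).
  by rewrite -sumP; apply: eq_bigr => q _; mlin.
rewrite -/(W a) -[W a](smul1l H) -(antipode_cancel_ll (B := fun x y => x ** W y)); last first.
  by split=> [y k u v|x k u v]; rewrite ?mulPl// lW mulPr.
apply: eq_bigr => p _; rewrite -[S p.1 in LHS](smul1r H) -(bilZr mulb) -iphi.
rewrite (copM (f := fun x y => phi y *: x)); last by mlin.
rewrite (bil_sumr mulb); apply: eq_bigr => q _; rewrite -smulA; congr (_ ** _).
rewrite exchange_big (bil_sumr mulb); apply: eq_bigr => i _.
rewrite linear_sum (bil_sumr mulb); apply: eq_bigr => r _.
by rewrite linearZ (bilZr mulb).
Qed.

(** The kernel M of the statement is a left coideal by [left_int_shift], in the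
    form of the hypothesis of [sum_bilinear_ker]; that lemma is used twice, with
    a map detecting S(x_1) x_2 and with one detecting x_1 e(x_2). *)
Lemma left_int_nondegenerate phi c x : left_int phi -> phi c != 0 ->
  (forall a, phi (a ** x) = 0) -> x = 0.
Proof.
move=> iphi cphi.
have lphi a : linear (fun x => phi (a ** x)) by mlin.
pose g a : {linear V -> K^o} := linear_pack (lphi a).
have ker (U : lmodType K) (B : V -> V -> U) : bilinear_map B ->
    (forall u v, (forall a, phi (a ** v) = 0) -> B u v = 0) ->
    forall x, (forall a, phi (a ** x) = 0) -> \sum_(p <- cop x) B p.1 p.2 = 0.
  move=> bB BM {}x xM; apply: (sum_bilinear_ker (g := g) bB) => // a /=.
  pose R c := \sum_(q <- cop x) phi (c ** q.2) *: q.1.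
  have lR : linear R by apply: linear_sumF => q; mlin.
  (* On [pi j a] only one term of the shift formula survives, and [sgn j] is
     invertible. *)
  rewrite -/(R a) -[a](spi_sum H) (lin_sum _ _ lR) big1//= => j _.
  have := left_int_shift (pi j a) x iphi.
  rewrite big1; last by move=> p _; rewrite xM scale0r.
  rewrite (bigD1 j)//= [X in _ + X]big1 ?addr0; last first.
    move=> i /negPf ij; rewrite big1 ?linear0// => q _.
    by rewrite spiK ij (bil0l mulb) linear0 scale0r.
  rewrite spiK eqxx -/(R (pi j a)) => /(congr1 (sgn j)).
  by rewrite sgnK linear0.
have epsM u : (forall a, phi (a ** u) = 0) -> eps u = 0.
  move=> uM; have : phi (c ** \sum_(p <- cop u) S p.1 ** p.2) = 0.
    rewrite (bil_sumr mulb) linear_sum.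
    apply: (ker _ (fun y z => phi (c ** (S y ** z)))) => //; first by mlin.
    by move=> y z zM; rewrite smulA.
  rewrite santl (bilZr mulb) (smul1r H) linearZ => /eqP.
  by rewrite mulf_eq0 (negPf cphi) orbF => /eqP.
move=> xM; rewrite -[x](scounitr H).
apply: (ker _ (fun y z => eps z *: y)) => //; first by mlin.
by move=> y z /epsM ->; rewrite scale0r.
Qed.

Section Homogeneous.
Context (t : bool) (theta : {linear V -> K^o}).
Context (theta_int : left_int theta).
Context (theta_hom : forall i x, theta (pi i x) = if i == t then theta x else 0).

(** This would follow from the antipode reversing coproducts; the following route
    avoids that fact. Let X(a, b) = theta(a S(b_1)) sgn_t(b_2) - a_1 theta(a_2 S(b)).
    Both terms of X(a b_1, b_2) collapse to theta(a) sgn_t(b), so it vanishes;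
    hence so does X(1, b) = X(S(b_1) b_2, b_3), which is the claim up to [sgn t]. *)
Lemma left_int_antipode b : \sum_(q <- cop b) theta (S q.1) *: q.2 = theta (S b) *: one.
Proof.
pose X a b := \sum_(q <- cop b) theta (a ** S q.1) *: sgn t q.2
  - \sum_(p <- cop a) theta (p.2 ** S b) *: p.1.
have bX : bilinear_map X.
  split=> [y k u v|x k u v]; rewrite /X /= scalerBr addrACA -opprD; congr (_ - _).
  - by rewrite -sumP; apply: eq_bigr => q _; mlin.
  - apply: (scop_linear H (f := fun x z => theta (z ** S y) *: x)); mlin.
  - apply: (scop_linear H (f := fun y z => theta (x ** S y) *: sgn t z)); mlin.
  - by rewrite -sumP; apply: eq_bigr => q _; mlin.
have X0 a c : \sum_(q <- cop c) X (a ** q.1) q.2 = 0.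
  rewrite /X sumrB; apply/eqP; rewrite subr_eq0; apply/eqP.
  transitivity (theta a *: sgn t c).
    rewrite -(scopA H (f := fun x y z => theta (a ** x ** S y) *: sgn t z)); last by mlin.
    transitivity (theta (a ** one) *: sgn t c); last by rewrite (smul1r H).
    rewrite -(antipode_cancel_rl (B := fun x y => theta (a ** x) *: sgn t y)); last by mlin.
    by apply: eq_bigr => q _; apply: eq_bigr => r _; rewrite smulA.
  transitivity (\sum_(p <- cop a) \sum_(i : bool) theta (pi i p.2) *: (p.1 ** sgn i c)).
    rewrite -[sgn t c](smul1l H) -(bilZl mulb) -theta_int (bil_suml mulb).
    apply: eq_bigr => p _; rewrite (bigD1 t)//= big1 ?addr0.
      by rewrite theta_hom eqxx (bilZl mulb).
    by move=> i /negPf it; rewrite theta_hom it scale0r.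
  transitivity (\sum_(q <- cop c) \sum_(p <- cop a) \sum_(r <- cop q.1) \sum_(i : bool)
      theta (pi i p.2 ** r.2 ** S q.2) *: (p.1 ** sgn i r.1)); last first.
    apply: eq_bigr => q _.
    by rewrite (copM (f := fun x y => theta (y ** S q.2) *: x)); last by mlin.
  (* With the coproduct of [a ** q.1] expanded, b_2 S(b_3) cancels and leaves
     theta(pi_i a_2), which selects the sign i = t. *)
  rewrite [RHS]exchange_big; apply: eq_bigr => p _ /=.
  under [RHS]eq_bigr => q _ do rewrite exchange_big.
  rewrite [RHS]exchange_big; apply: eq_bigr => i _ /=.
  transitivity (theta (pi i p.2 ** one) *: (p.1 ** sgn i c)); first by rewrite (smul1r H).
  rewrite -(antipode_cancel_rr (B := fun x y => theta (pi i p.2 ** y) *: (p.1 ** sgn i x))).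
    by apply: eq_bigr => q _; apply: eq_bigr => r _; rewrite smulA.
  by mlin.
have : X one b = 0.
  by rewrite -(antipode_cancel_ll _ bX) big1// => p _; exact: X0.
rewrite /X (scop1 H (f := fun x y => theta (y ** S b) *: x)); last by mlin.
rewrite (smul1l H) => /eqP; rewrite subr_eq0 => /eqP /(congr1 (sgn t)).
rewrite linearZ /= sgn1 => <-; rewrite linear_sum; apply: eq_bigr => q _.
by rewrite linearZ /= sgnK (smul1l H).
Qed.

(** The key identity is [phi (sgn t a ** f b) = theta (S a) * phi b]: its right side
    depends on [b] through [phi b] only, and [left_int_nondegenerate] turns this
    into a statement on [f b]. *)
Lemma left_int_proportional phi z : left_int phi -> phi z != 0 ->
  exists c : K, theta = c *: phi.
Proof.
move=> iphi zphi.
pose f b := \sum_(p <- cop b) theta p.1 *: p.2.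
have key a b : phi (sgn t a ** f b) = theta (S a) * phi b.
  transitivity (theta (\sum_(p <- cop a) phi (p.2 ** b) *: S p.1)); last first.
    rewrite linear_sum -[b in RHS](smul1l H) -[RHS]formZ.
    rewrite -(bilZl mulb) -left_int_antipode (bil_suml mulb) linear_sum.
    apply: eq_bigr => p _.
    by rewrite (bilZl mulb) !formZ mulrC.
  rewrite left_int_shift// sgnE (bil_suml mulb) !linear_sum; apply: eq_bigr => i _.
  have sgn_theta x : theta (sgn i x) = (-1) ^+ (i && t) * theta x.
    rewrite sgnE linear_sum (bigD1 t)//= big1 ?addr0.
      by rewrite formZ theta_hom eqxx andbC.
    by move=> j /negPf jt; rewrite formZ theta_hom jt mulr0.
  rewrite sgn_theta (bilZl mulb) formZ; congr (_ * _).
  rewrite (bil_sumr mulb) !linear_sum; apply: eq_bigr => q _.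
  by rewrite (bilZr mulb) !formZ mulrC.
have epsf b : eps (f b) = theta b.
  rewrite -[b in RHS](scounitr H) !linear_sum; apply: eq_bigr => p _.
  by rewrite !formZ mulrC.
exists (theta z / phi z); apply: linear_ext => b.
have /eqP : phi z *: f b - phi b *: f z = 0.
  apply: (left_int_nondegenerate iphi zphi) => a; rewrite -[a](sgnK t).
  rewrite (bilBr mulb) !(bilZr mulb) linearB !(formZ phi) !key.
  by rewrite mulrCA [phi b * _]mulrCA [phi b * _]mulrC subrr.
rewrite subr_eq0 => /eqP /(congr1 eps); rewrite !formZ !epsf homZE.
move=> E; apply: (mulfI zphi); rewrite E /GRing.scale /=.
by rewrite mulrA mulrCA divff// mulr1 mulrC.
Qed.

End Homogeneous.

Lemma left_int_sum phi : (forall i, left_int (phi \o pi i)) -> left_int phi.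
Proof.
have phiE x : phi x = \sum_(i : bool) phi (pi i x) by rewrite -linear_sum spi_sum.
move=> iphi a; rewrite phiE scaler_suml.
rewrite -[RHS](eq_bigr _ (fun i _ => iphi i a)) exchange_big; apply: eq_bigr => p _ /=.
by rewrite phiE scaler_suml.
Qed.

(** If [phi \o pi t] is a nonzero multiple of [phi], the two have the same kernel,
    and the first one vanishes on the part of the other degree. *)
Lemma left_int_homogeneous phi :
  (forall i, left_int (phi \o pi i)) ->
  exists t, forall i x, phi (pi i x) = if i == t then phi x else 0.
Proof.
move=> iphi; pose phii i := (phi \o pi i : {linear V -> K^o}).
have phiE x : phi x = \sum_(i : bool) phi (pi i x) by rewrite -linear_sum spi_sum.
have lphi := left_int_sum iphi.
have [phi0|/existsNP[z /eqP phiz]] := pselect (forall x, phi x = 0).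
  by exists false => i x; rewrite !phi0 if_same.
have hom i j x : phii i (pi j x) = if j == i then phii i x else 0.
  by rewrite /= spiK eq_sym; case: eqP => // _; rewrite linear0.
have /existsNP[t /eqP phit] : ~ forall i, phi (pi i z) = 0.
  by move=> phi0; move/eqP: phiz; apply; rewrite phiE big1.
have [c cE] := left_int_proportional (iphi t) (hom t) lphi phiz.
have cphi x : phi (pi t x) = c * phi x by rewrite -[LHS]/(phii t x) /phii cE.
have c0 : c != 0 by apply: contraNneq phit => c0; rewrite cphi c0 mul0r.
have pi0 i x : i != t -> phi (pi i x) = 0.
  move=> it; apply: (mulfI c0); rewrite -cphi spiK eq_sym (negPf it).
  by rewrite linear0 mulr0.
exists t => i x; case: eqP => [->|/eqP it]; last exact: pi0.
by rewrite [RHS]phiE (bigD1 t)//= big1 ?addr0// => j; exact: pi0.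
Qed.

End Uniqueness.

(** * Exchanging left and right *)

Section Mirror.
Context (K : fieldType) (V : lmodType K) (H : signed_hopf V).

Let mcop (a : V) := [seq (p.2, p.1) | p <- scop H a].

Lemma mcopE (U : lmodType K) (f : V -> V -> U) a :
  \sum_(p <- mcop a) f p.1 p.2 = \sum_(p <- scop H a) f p.2 p.1.
Proof. by rewrite big_map. Qed.

Let flip (U : lmodType K) (f : V -> V -> U) : bilinear_map f -> bilinear_map (fun x y => f y x).
Proof. by move=> bf; split=> [x|y]; [exact: bf.2|exact: bf.1]. Qed.

(** No sign is inserted when products and coproducts are reversed: the product
    rule is symmetric under the exchange of its two sums over degrees. *)
Definition mirror : signed_hopf V.
Proof.
refine (@SignedHopf K V (fun x y => smul H y x) (sone H) (seps H) (sant H) (spi H) mcop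
  (flip (smul_bilinear H)) _ (smul1r H) (smul1l H) (@spiK _ _ H) (spi_sum H) (spi1 H)
  _ _ _ _ _ _ _ _).
- by move=> x y z; rewrite smulA.
- move=> U f bf k x y; rewrite !mcopE; exact: (scop_linear H (flip bf)).
- move=> U f [f1 f2 f3] a.
  under eq_bigr => p _ do rewrite (mcopE (fun x y => f x y p.2)).
  rewrite (mcopE (fun x y => \sum_(q <- scop H x) f q.2 q.1 y)).
  rewrite -(scopA H (f := fun x y z => f z y x)) //; symmetry.
  under eq_bigr => p _ do rewrite (mcopE (f p.1)).
  exact: (mcopE (fun x y => \sum_(q <- scop H y) f x q.2 q.1)).
- by move=> a; rewrite (mcopE (fun x y => seps H x *: y)) scounitr.
- by move=> a; rewrite (mcopE (fun x y => seps H y *: x)) scounitl.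
- by move=> a; rewrite (mcopE (fun x y => smul H y (sant H x))) santr.
- by move=> a; rewrite (mcopE (fun x y => smul H (sant H y) x)) santl.
- by move=> U f bf; rewrite mcopE (scop1 H (flip bf)).
- move=> U f bf a b; rewrite mcopE (scopM H (flip bf)).
  rewrite big_map exchange_big; apply: eq_bigr => p _; rewrite big_map; apply: eq_bigr => q _.
  by rewrite exchange_big; apply: eq_bigr => i _; apply: eq_bigr => j _; rewrite andbC.
Defined.

Lemma left_int_mirror phi :
  (forall a, \sum_(p <- scop H a) phi p.1 *: p.2 = phi a *: sone H) ->
  left_int mirror phi.
Proof. by move=> h a; rewrite -[RHS]h (mcopE (fun x y => phi y *: x)). Qed.

End Mirror.

(** * Degrees, forms and tensors *)

Section Degrees.
Context (K : fieldType).

Lemma hcompK (V : superModType K) i j (v : V) :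
  hcomp i (hcomp j v) = if i == j then hcomp i v else 0.
Proof. by rewrite (hcomp_homog i (homog_hcomp j v)); case: eqP => [->|]. Qed.

Lemma homog_ground (d : bool) (k : K^o) : (d -> k = 0) -> homog d k.
Proof. by []. Qed.

Lemma form_homog (V : superModType K) t (I : {linear V -> K^o}) :
  (forall i v, I (hcomp i v) = if i == t then I v else 0) -> homog t I.
Proof.
move=> It; suff Ideg p v : homog p v -> homog (p (+) t) (I v) by exact: Ideg.
move=> pv; apply: homog_ground; case: (eqVneq p t) => [->|pt]; rewrite ?addbb//.
by move=> _; have := It p v; rewrite (hcomp_homog _ pv) eqxx (negPf pt).
Qed.

Lemma hcomp_form (V : superModType K) (I : {linear V -> K^o}) i v :
  hcomp i I v = I (hcomp i v).
Proof.
have cI d : homog d (I \o hcomp d : {linear V -> K^o}).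
  apply: form_homog => j w /=; rewrite (hcomp_homog _ (homog_hcomp j w)) eq_sym.
  by case: eqP => [->|]; rewrite ?linear0.
rewrite (hcomp_uniq cI) //; apply: linear_ext => w; rewrite big_bool homDE /= -linearD.
by congr (I _); rewrite [LHS]hcomp_sum big_bool.
Qed.

Lemma bilinear_hcomp (V W : superModType K) (U : lmodType K) (f : V -> W -> U) d :
  bilinear_map f ->
  bilinear_map (fun v w => \sum_(k : bool) f (hcomp k v) (hcomp (k (+) d) w)).
Proof.
move=> bf; apply: bilinear_sumF => k.
by split=> [w c u v|v c u w]; rewrite linearP; [exact: bf.1|exact: bf.2].
Qed.

(** A tensor of degree [e] is a sum of [v \ot w] with [v] and [w] homogeneous of
    total degree [e], so testing it on the part of [f] of total degree [d] sees
    everything when [d] is [e], and nothing otherwise. *)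
Lemma tlift_homog (V W : superModType K) (U : lmodType K) (f : V -> W -> U) d e (x : tensor V W) :
  bilinear_map f -> homog e x ->
  tlift (fun v w => \sum_(k : bool) f (hcomp k v) (hcomp (k (+) d) w)) x =
  if d == e then tlift f x else 0.
Proof.
move=> bf [s [hs ->]].
have bF := bilinear_hcomp d bf.
rewrite !(lin_sum _ _ (tlift_linear _))//.
transitivity (\sum_(t <- s) if d == e then tlift f (t.2.1 \ot t.2.2) else 0); last first.
  by case: eqP => // _; rewrite big1.
rewrite big_seq [RHS]big_seq; apply: eq_bigr => -[p [v w]] /hs[pv pw] /=.
rewrite !tliftE// big_bool !(hcomp_homog _ pv) !(hcomp_homog _ pw).
case: p d e {pv pw hs bF} => -[] [] /=;
  by rewrite ?(bil0l bf) ?(bil0r bf) ?addr0 ?add0r.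
Qed.

Lemma idfun_even (V : superModType K) : homog false (idfun : {linear V -> V}).
Proof. by move=> p v; rewrite addbF. Qed.

Lemma tmap_even (V V' W W' : superModType K) (f : {linear V -> V'}) (g : {linear W -> W'}) v w :
  homog false g -> tmap_fun f g v w = f v \ot g w.
Proof.
move=> g0; rewrite /tmap_fun !big_bool !(hcomp_homog _ g0) /= !tpure0r !scaler0 !add0r.
by rewrite !expr0 !scale1r -tpureDl -linearD; congr (f _ \ot _); rewrite [RHS]hcomp_sum big_bool.
Qed.

Lemma tmap_sum (V V' W W' : superModType K) (f : {linear V -> V'}) (g : {linear W -> W'}) x :
  homog false g -> tmap f g x = \sum_(p <- tensor_repr x) f p.1 \ot g p.2.
Proof. by move=> g0; apply: eq_bigr => p _; exact: tmap_even. Qed.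

Lemma lin_tmap (V V' W W' : superModType K) (U : lmodType K)
    (f : {linear V -> V'}) (g : {linear W -> W'}) (B : V' -> W' -> U) (x : tensor V W) :
  homog false g -> bilinear_map B ->
  tlift B (tmap f g x) = \sum_(p <- tensor_repr x) B (f p.1) (g p.2).
Proof.
move=> g0 bB; rewrite tmap_sum// (lin_sum _ _ (tlift_linear bB)).
by apply: eq_bigr => p _; rewrite tliftE.
Qed.

Lemma scale_bilinear (V : lmodType K) : bilinear_map (fun (k : K^o) (v : V) => k *: v).
Proof. by split=> [v k c d|c k u v] /=; rewrite ?scalePl ?scalePr. Qed.

Lemma scaler_bilinear (V : lmodType K) : bilinear_map (fun (v : V) (k : K^o) => k *: v).
Proof. by split=> [c k u v|v k c d] /=; rewrite ?scalePl ?scalePr. Qed.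

End Degrees.

(** * Integrals on a Hopf superalgebra *)

Section Super.
Context (K : fieldType) (A : hopfSuperAlgType K).

Let cop (a : A) := tensor_repr (comul a).

(** The coproduct, the counit and the antipode are even, so that the tensor maps
    of the axioms insert no sign. *)
Definition super_hopf : signed_hopf A.
Proof.
refine (@SignedHopf K A (fun x y => x * y) 1 counit antipode (fun i => hcomp i)
  cop (mult_bilinear A) (@mulrA A) (@mul1r A) (@mulr1 A) _ _ _ _ _ _ _ _ _ _ _).
- exact: hcompK.
- by move=> x /=; rewrite [RHS]hcomp_sum.
- by rewrite /= (hcomp_homog false (homog1 (s := A))).
- by move=> U f bf k x y; rewrite -[LHS]/(tlift f _) linearP tlift_linear.
- move=> U f [f1 f2 f3] a.
  have bf x : bilinear_map (f x) by split=> *; [exact: f2|exact: f3].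
  pose F x t := tlift (f x) t.
  have bF : bilinear_map F.
    split=> [t|x]; last exact: tlift_linear.
    by apply: linear_sumF => p; exact: f1.
  have := congr1 (tlift F) (comulA a); rewrite (lin_tmap _ _ comul_even bF).
  move=> <-.
  have lT : linear (fun x => tlift F (tassoc x)).
    by move=> k x y; rewrite linearP tlift_linear.
  rewrite tmap_sum; last exact: idfun_even.
  rewrite (lin_sum _ _ lT); apply: eq_bigr => p _.
  rewrite [comul p.1 in RHS]tensorE (bil_suml (tpure_bilinear _ _)) (lin_sum _ _ lT).
  by apply: eq_bigr => q _; rewrite tassocE tliftE// /F tliftE.
- move=> a; have := congr1 (tlift (fun (k : K^o) v => k *: v)) (counitl a).
  rewrite lin_tmap ?tliftE ?scale1r//;
    [exact: scale_bilinear|exact: idfun_even|exact: scale_bilinear].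
- move=> a; have := congr1 (tlift (fun v (k : K^o) => k *: v)) (counitr a).
  rewrite lin_tmap ?tliftE ?scale1r//;
    [exact: scaler_bilinear|exact: counit_even|exact: scaler_bilinear].
- by move=> a; rewrite -antipodel /mult lin_tmap//; [exact: idfun_even|exact: mult_bilinear].
- by move=> a; rewrite -antipoder /mult lin_tmap//; [exact: antipode_even|exact: mult_bilinear].
- by move=> U f bf; rewrite -[LHS]/(tlift f (comul 1)) comul1 tliftE.
- move=> U f bf a b; rewrite -[LHS]/(tlift f (comul (a * b))) comulM.
  rewrite /tensor_mul [X in tlift f X]/tlift (lin_sum _ _ (tlift_linear bf)).
  apply: eq_bigr => p _; rewrite (lin_sum _ _ (tlift_linear bf)).
  apply: eq_bigr => q _.
  rewrite /tensor_mul_fun (lin_sum _ _ (tlift_linear bf)); apply: eq_bigr => i _.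
  rewrite (lin_sum _ _ (tlift_linear bf)); apply: eq_bigr => j _.
  by rewrite (scalable_linear (tlift_linear bf)) tliftE.
Defined.

Lemma comul_hcomp (U : lmodType K) (f : A -> A -> U) d a : bilinear_map f ->
  \sum_(p <- cop (hcomp d a)) f p.1 p.2 =
  \sum_(p <- cop a) \sum_(k : bool) f (hcomp k p.1) (hcomp (k (+) d) p.2).
Proof.
move=> bf; pose g v w := \sum_(k : bool) f (hcomp k v) (hcomp (k (+) d) w).
have bg : bilinear_map g := bilinear_hcomp d bf.
rewrite -[LHS]/(tlift f _) -[RHS]/(tlift g (comul a)) {2}[a]hcomp_sum linear_sum.
have hdeg e : homog e (comul (hcomp e a)).
  by have := comul_even _ _ (homog_hcomp e a); rewrite addbF.
rewrite (lin_sum _ _ (tlift_linear bg)) (bigD1 d)//= big1 ?addr0.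
  by rewrite (tlift_homog d bf (hdeg d)) eqxx.
by move=> e /negPf ed; rewrite (tlift_homog d bf (hdeg e)) eq_sym ed.
Qed.

(** In the identity for [hcomp d a], the term where [I] has degree n lies in
    degree d + n, whereas the right side is a multiple of 1, of degree 0. So the
    component of [I] of degree d satisfies the identity, and the other one
    contributes 0 on both sides. The sign that remains is trivial when n = d. *)
Lemma left_integral_components (I : {linear A -> K^o}) : left_integral I ->
  forall m, left_int super_hopf (I \o hcomp m).
Proof.
move=> hI m a; pose f (v w : A) : A :=
  \sum_(i : bool) \sum_(j : bool) (-1) ^+ (i && j) *: ((I (hcomp i w) : K) *: hcomp j v).
have bf : bilinear_map f.
  do 2![apply: bilinear_sumF => ?].
  split=> [w c u v|v c u w] /=; first by rewrite ?(linearP, scalePr).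
  rewrite 2!linearP -scalePr scalerDl; congr (_ *: (_ + _)); exact/esym/scalerA.
have fE b : \sum_(p <- cop b) f p.1 p.2 = (I b : K) *: 1.
  have := congr1 (tlift (fun v (k : K^o) => k *: v)) (hI b).
  rewrite tliftE => [<-|]; last exact: scaler_bilinear.
  have lS := tlift_linear (scaler_bilinear A).
  rewrite [X in tlift _ X]/tlift (lin_sum _ _ lS); apply: eq_bigr => p _.
  rewrite /tmap_fun (lin_sum _ _ lS); apply: eq_bigr => i _.
  rewrite (lin_sum _ _ lS); apply: eq_bigr => j _.
  rewrite (scalable_linear lS) tliftE ?hcomp_form//; exact: scaler_bilinear.
pose L n := \sum_(p <- cop a) (I (hcomp n p.2) : K) *: p.1.
have proj e d : (-1) ^+ (e && (e (+) d)) *: hcomp e (L (e (+) d)) =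
    if e then 0 else (I (hcomp d a) : K) *: 1.
  have := fE (hcomp d a); rewrite comul_hcomp// => /(congr1 (hcomp e)).
  rewrite linearZ /= (hcomp_homog e (homog1 (s := A))) => E.
  transitivity ((I (hcomp d a) : K) *: (if e == false then 1 else 0 : A)); last first.
    by case: e {E} => /=; rewrite ?scaler0.
  rewrite -E !linear_sum; apply: eq_bigr => p _.
  rewrite linear_sum (bigD1 e)//= [X in _ + X]big1 ?addr0.
    rewrite /f (bigD1 (e (+) d))//= [X in _ + X]big1 ?addr0; last first.
      by move=> i /negPf ie; rewrite big1// => j _; rewrite hcompK ie linear0 scale0r scaler0.
    rewrite (bigD1 e)//= [X in _ + X]big1 ?addr0; last first.
      by move=> j /negPf je; rewrite (hcompK j e) je !scaler0.
    rewrite !linearZ /= !hcompK !eqxx andbC !scalerA.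
    by congr (_ *: _); exact: mulrC.
  move=> k /negPf ke; rewrite /f !linear_sum big1// => i _.
  rewrite linear_sum big1// => j _.
  by rewrite !linearZ /= !(hcompK e) (eq_sym e k) ke if_same !scaler0.
rewrite -[LHS]/(L m) [L m]hcomp_sum big_bool.
have := proj true (~~ m); have := proj false m.
rewrite addFb /= negbK scale1r => -> /eqP; rewrite scaler_eq0 signr_eq0 => /eqP ->.
by rewrite add0r.
Qed.

(** The same comparison of degrees; here no sign arises, as the second factor of
    [tmap I idfun] is even. *)
Lemma right_integral_components (I : {linear A -> K^o}) : right_integral I ->
  forall m, left_int (mirror super_hopf) (I \o hcomp m).
Proof.
move=> hI m; apply: left_int_mirror => a /=.
pose f (v w : A) : A := (I v : K) *: w.
have bf : bilinear_map f.
  split=> [w c u v|v c u w]; rewrite /f /= ?linearP//.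
  by rewrite scalerDl; congr (_ + _); exact/esym/scalerA.
have fE b : \sum_(p <- cop b) f p.1 p.2 = (I b : K) *: 1.
  have := congr1 (tlift (fun (k : K^o) v => k *: v)) (hI b).
  rewrite lin_tmap ?tliftE//;
    [exact: scale_bilinear|exact: idfun_even|exact: scale_bilinear].
pose L n := \sum_(p <- cop a) (I (hcomp n p.1) : K) *: p.2.
have proj e d : hcomp e (L (e (+) d)) = if e then 0 else (I (hcomp d a) : K) *: 1.
  have := fE (hcomp d a); rewrite comul_hcomp// => /(congr1 (hcomp e)).
  rewrite linearZ /= (hcomp_homog e (homog1 (s := A))) => E.
  transitivity ((I (hcomp d a) : K) *: (if e == false then 1 else 0 : A)); last first.
    by case: e {E} => /=; rewrite ?scaler0.
  rewrite -E !linear_sum; apply: eq_bigr => p _.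
  rewrite linear_sum (bigD1 (e (+) d))//= [X in _ + X]big1 ?addr0.
    by rewrite /f !linearZ /= -addbA addbb addbF hcompK eqxx.
  move=> k ke; rewrite /f linearZ /= hcompK.
  case: (eqVneq e (k (+) d)) ke => [->|_ _]; rewrite ?scaler0//.
  by rewrite -addbA addbb addbF eqxx.
rewrite -[LHS]/(L m) [L m]hcomp_sum big_bool.
have := proj true (~~ m); have := proj false m.
by rewrite addFb /= negbK => -> ->; rewrite add0r.
Qed.

Lemma integral_homog (I : {linear A -> K^o}) : left_integral I \/ right_integral I ->
  homog false I \/ homog true I.
Proof.
move=> hI; have [t It] : exists t, forall i x, I (hcomp i x) = if i == t then I x else 0.
  case: hI => [/left_integral_components|/right_integral_components] hI.
    exact: (left_int_homogeneous hI).
  exact: (left_int_homogeneous hI).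
by case: t It => /form_homog; [right|left].
Qed.

Lemma left_integral_dim : exists2 n : nat, (n <= 1)%N & has_dim (@left_integral K A) n.
Proof.
have [[J [hJ [z Jz]]]|noJ] :=
    pselect (exists J : {linear A -> K^o}, left_integral J /\ exists z, J z <> 0).
  exists 1%N => //; exists (fun=> J); split=> //.
    move=> c; rewrite big_ord1 => cJ i; rewrite (ord1 i).
    have /eqP : c ord0 * J z = 0 by rewrite -[LHS]/((c ord0 *: J) z) cJ.
    by rewrite mulf_eq0 => /orP[/eqP//|/eqP].
  move=> I hI; have [t It] := left_int_homogeneous (left_integral_components hI).
  have intT I' (hI' : left_integral I') :=
    left_int_sum (H := super_hopf) (left_integral_components hI').
  have /eqP Jz' := Jz.
  have [c ->] := left_int_proportional (intT _ hI) It (intT _ hJ) Jz'.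
  by exists (fun=> c); rewrite big_ord1.
exists 0%N => //; exists (fun=> 0); split=> [[]//|c _ []//|I hI].
exists (fun=> 0); rewrite big_ord0; apply: linear_ext => z.
by apply: contrapT => Iz; apply: noJ; exists I; split=> //; exists z.
Qed.

End Super.

Theorem theorem1 (R : realType) (A : hopfSuperAlgType R[i]) :
  (exists2 n : nat, (n <= 1)%N & has_dim (@left_integral R[i] A) n) /\
  (forall I : {linear A -> R[i]^o}, left_integral I \/ right_integral I ->
     homog false I \/ homog true I).
Proof. by split; [exact: left_integral_dim|exact: integral_homog]. Qed.
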